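(* For all integers $n\ge m\ge 1$, $$n\sqrt{\tfrac m2}-O(n+\sqrt m)\ \le\ \eta(K_n\,\square\,K_m)\ <\ \sqrt{(n+m-4)nm}+3\ \le\ n\sqrt{2m}+3.$$
   Context: All graphs are finite, simple and undirected. $K_n$ is the complete graph on $n$ vertices. The Cartesian product $G\,\square\,H$ has vertex set $V(G)\times V(H)$, with $(v,x)(w,y)$ an edge iff ($vw\in E(G)$ and $x=y$) or ($v=w$ and $xy\in E(H)$). $\eta(G)$ is the maximum $k$ such that $K_k$ is a minor of $G$.
   Formalization: The strict upper bound fails at (n,m) = (3,1) and (2,2), where both sides equal 3; it is claimed only for n+m ≠ 4, with ≤ in all cases. For (1,1) and (2,1), where n+m−4 < 0, the square root is read as 0. *)

(* Defs.v *)
From HB Require Import structures.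
From mathcomp Require Import all_boot all_order all_algebra.
From mathcomp Require Import reals.

Set Implicit Arguments.
Unset Strict Implicit.
Unset Printing Implicit Defensive.

Record sgraph := SGraph {
  vertex :> finType;
  edge : rel vertex;
  edge_sym : symmetric edge;
  edge_irrefl : irreflexive edge }.

Section Complete.
Variable n : nat.
Definition complete_edge : rel 'I_n := [rel i j | i != j].
Lemma complete_edge_sym : symmetric complete_edge.
Proof. by move=> i j; rewrite /complete_edge /= eq_sym. Qed.
Lemma complete_edge_irrefl : irreflexive complete_edge.
Proof. by move=> i; rewrite /complete_edge /= eqxx. Qed.
Definition complete_graph : sgraph :=
  SGraph complete_edge_sym complete_edge_irrefl.
End Complete.

Section Product.
Variables G H : sgraph.
Definition cart_edge : rel (G * H)%type :=
  [rel p q | edge p.1 q.1 && (p.2 == q.2) || (p.1 == q.1) && edge p.2 q.2].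
Lemma cart_edge_sym : symmetric cart_edge.
Proof.
move=> p q; rewrite /cart_edge /= [edge p.1 _]edge_sym [edge p.2 _]edge_sym.
by rewrite [p.1 == _]eq_sym [p.2 == _]eq_sym.
Qed.
Lemma cart_edge_irrefl : irreflexive cart_edge.
Proof. by move=> p; rewrite /cart_edge /= !edge_irrefl andbF. Qed.
Definition cart_prod : sgraph := SGraph cart_edge_sym cart_edge_irrefl.
End Product.

(* The subgraph of G induced by S is connected; as usual, a connected graph
   has at least one vertex. *)
Definition connected_set (G : sgraph) (S : {set G}) : bool :=
  (S != set0) &&
  [forall u in S, forall v in S,
     connect [rel x y | [&& x \in S, y \in S & edge x y]] u v].

(* H is a minor of G, i.e. H arises from a subgraph of G by contracting edges:
   B x is the branch set contracted to the vertex x of H.  The branch sets need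
   not cover G, and edges of G between the branch sets of nonadjacent vertices
   of H are allowed, since vertices and edges of G may be deleted. *)
Definition minor (H G : sgraph) : bool :=
  [exists B : {ffun H -> {set G}},
    [&& [forall x, connected_set (B x)],
        [forall x, forall y, (x != y) ==> [disjoint B x & B y]]
      & [forall x, forall y, edge x y ==>
           [exists u in B x, exists v in B y, edge u v]]]].

(* The restriction to k <= #|G| loses nothing: see hadwigerP. *)
Definition hadwiger (G : sgraph) : nat :=
  \max_(k < #|G|.+1 | minor (complete_graph k) G) k.

Lemma minor_card (H G : sgraph) : minor H G -> #|H| <= #|G|.
Proof.
case/existsP=> B /and3P[/forallP conB /forallP disB _].
have neB x : exists u, u \in B x.
  by apply/set0Pn; case/andP: (conB x).
pose f x := xchoose (neB x).
have fB x : f x \in B x by apply: xchooseP.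
apply: (@leq_card _ _ f) => x y fxy; apply: contraTeq isT => nxy.
have /implyP/(_ nxy)/disjoint_setI0/setP/(_ (f x)) := forallP (disB x) y.
by rewrite !inE fB fxy fB.
Qed.

Lemma hadwigerP (G : sgraph) :
  minor (complete_graph (hadwiger G)) G /\
  forall k, minor (complete_graph k) G -> k <= hadwiger G.
Proof.
split; last first.
  move=> k kG; have := minor_card kG; rewrite card_ord -ltnS => lt_k.
  exact: (leq_bigmax_cond (Ordinal lt_k) kG).
have G0 : minor (complete_graph (ord0 : 'I_#|G|.+1)) G.
  by apply/existsP; exists [ffun=> set0]; apply/and3P; split; apply/forallP=> -[].
rewrite /hadwiger (@bigmax_eq_arg _ ord0
  (fun k : 'I_#|G|.+1 => minor (complete_graph k) G) (@nat_of_ord _) G0).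
by case: arg_maxnP.
Qed.

(* Main.v *)
Require Import Defs.
From mathcomp Require Import all_boot all_order all_algebra.
From mathcomp Require Import reals zify ring lra.

(**
Upper bound: grow a branch set S one vertex at a time.  Each new vertex spends
one edge towards the part already built, so in a graph of maximum degree D the
set S has at most |S|(D - 2) + 2 outside neighbours.  In a K_k-minor every
branch set has at least k - 1 of them, and summing over the k disjoint branch
sets gives k^2 <= |G|(D - 2) + 3k, where D = n + m - 2.

Lower bound: take t maximal with t(t+1)/2 <= m and index rows of the n x m grid
by pairs u <= v < t.  The branch set (w, a), with w < t and a < n/2, consists of
the rows (w, v) in column 2a and the rows (u, w) in column 2a+1.  Both parts
contain row (w, w), which joins them, and the sets (w, a) and (w', b) with
w <= w' both meet row (w, w').  Hence eta >= t * floor(n/2).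
*)

Set Implicit Arguments.
Unset Strict Implicit.
Unset Printing Implicit Defensive.

Import Order.TTheory GRing.Theory Num.Theory.

(** * Neighbourhoods of connected sets and the upper bound *)

Section UpperBound.
Local Open Scope nat_scope.

Definition nbhd (G : sgraph) (S : {set G}) : {set G} :=
  [set y | (y \notin S) && [exists x in S, edge x y]].

Definition max_degree_le (G : sgraph) (D : nat) : Prop :=
  forall x : G, #|[set y | edge x y]| <= D.

Lemma connect_in_sym (G : sgraph) (S : {set G}) :
  connect_sym [rel x y : G | [&& x \in S, y \in S & edge x y]].
Proof.
by apply: sym_connect_sym => x y /=; rewrite edge_sym andbCA.
Qed.

(** Otherwise [T] would be closed under the edges inside [S], and no path in [S] could lead from a
    point of [T] to a point of [S] outside [T]. *)
Lemma connected_set_exit (G : sgraph) (S T : {set G}) :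
  connected_set S -> T \proper S -> T != set0 ->
  exists2 x, x \in T & exists2 y, y \in S :\: T & edge x y.
Proof.
case/andP=> _ conS /properP[sTS [v vS vT]] /set0Pn[u uT].
have uv := implyP (forallP (implyP (forallP conS u) (subsetP sTS u uT)) v) vS.
case: (boolP [exists x in T, exists y in S :\: T, edge x y]).
  by move=> /exists_inP[x xT /exists_inP[y yST xy]]; exists x => //; exists y.
move=> noexit; case/negP: vT.
suff clT : closed [rel x y : G | [&& x \in S, y \in S & edge x y]] (mem T).
  by rewrite -(closed_connect clT uv).
apply: intro_closed; first exact: connect_in_sym.
move=> x y /= /and3P[_ yS xy] xT; apply: contraNT noexit => yT.
apply/exists_inP; exists x => //; apply/exists_inP; exists y => //.
by rewrite inE yS andbT.
Qed.

Lemma card_nbhd_connected (G : sgraph) (d : nat) (S : {set G}) :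
  max_degree_le G d.+2 -> connected_set S -> #|nbhd S| <= #|S| * d + 2.
Proof.
move=> degG conS.
have grow s : s < #|S| ->
    exists T : {set G}, [/\ T \subset S, #|T| = s.+1 & #|nbhd T| <= s.+1 * d + 2].
  elim: s => [_|s IHs lt_s].
    have /set0Pn[u uS] := proj1 (andP conS).
    exists [set u]; rewrite sub1set cards1; split=> //.
    apply: leq_trans (subset_leq_card _) _; last by rewrite mul1n addn2; exact: (degG u).
    by apply/subsetP=> y; rewrite !inE => /andP[_ /exists_inP[x /set1P->]].
  have [T [sTS cT leT]] := IHs (ltnW lt_s).
  have [||x xT [w]] := connected_set_exit conS (T := T).
  - by rewrite properEcard sTS cT.
  - by rewrite -card_gt0 cT.
  rewrite inE => /andP[wT wS] xw; exists (w |: T).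
  rewrite subUset sub1set wS sTS cardsU1 wT cT; split=> //.
  have wN : w \in nbhd T by rewrite inE wT; apply/exists_inP; exists x.
  have xN : x \in [set y | edge w y] by rewrite inE edge_sym.
  (* [w] leaves the neighbourhood and at most [d + 1] of its neighbours enter, since [x] already
     lies in [T]; the net gain is at most [d]. *)
  have sub : nbhd (w |: T) \subset (nbhd T :\ w) :|: ([set y | edge w y] :\ x).
    apply/subsetP=> y; rewrite !inE negb_or => /andP[/andP[yw yT]].
    case/exists_inP=> z; rewrite !inE yw yT => /orP[/eqP->|zT] zy.
      apply/orP; right; rewrite zy andbT.
      by apply: contraNneq yT => ->.
    by apply/orP; left; apply/exists_inP; exists z.
  have := leq_trans (subset_leq_card sub) (leq_card_setU _ _).
  have := degG w; have := cardsD1 w (nbhd T); have := cardsD1 x [set y | edge w y].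
  rewrite wN xN; nia.
have S_gt0 : 0 < #|S| by rewrite card_gt0; case/andP: conS.
have [|T [sTS cT]] := grow #|S|.-1; first by rewrite prednK.
rewrite prednK // in cT *.
by have /eqP-> : T == S by rewrite eqEcard sTS cT leqnn.
Qed.

Lemma complete_minor_bound (G : sgraph) (d k : nat) :
  max_degree_le G d.+2 -> minor (complete_graph k) G ->
  k * k <= #|G| * d + 3 * k.
Proof.
move=> degG /existsP[B /and3P[/forallP conB /forallP disB /forallP adjB]].
have disjB x y u : u \in B x -> u \in B y -> x = y.
  move=> ux uy; apply/eqP; apply: contraTT isT => nxy.
  have := implyP (forallP (disB x) y) nxy.
  by move/disjoint_setI0/setP/(_ u); rewrite !inE ux uy.
have k_le (x : complete_graph k) : k <= #|B x| * d + 3.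
  have [u uB] : exists u, u \in B x by apply/set0Pn; case/andP: (conB x).
  (* Choose in every other branch set a neighbour of [B x]; disjointness makes these [k - 1] choices
     distinct. The value at [y = x] is a dummy. *)
  have /fin_all_exists[f fP] : forall y : complete_graph k, exists v,
      y != x -> v \in B y /\ v \in nbhd (B x).
    move=> y; have [->|nyx] := eqVneq y x; first by exists u.
    have /implyP/(_ _)/exists_inP[|z zx /exists_inP[v vy zv]] := forallP (adjB x) y.
      by rewrite /= /complete_edge /= eq_sym.
    exists v => _; split=> //; rewrite inE; apply/andP; split.
      by apply: contraNN nyx => vx; rewrite (disjB _ _ _ vy vx).
    by apply/exists_inP; exists z.
  have inj_f : {in [set~ x] &, injective f}.
    move=> y z; rewrite !inE => /fP[yB _] /fP[zB _] fyz.
    by apply: disjB yB _; rewrite fyz.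
  have sub_f : f @: [set~ x] \subset nbhd (B x).
    by apply/subsetP=> _ /imsetP[y + ->]; rewrite !inE => /fP[_]; rewrite inE.
  have := subset_leq_card sub_f; rewrite card_in_imset // cardsC1 card_ord.
  move/leq_trans/(_ (card_nbhd_connected degG (conB x))).
  by rewrite -subn1 leq_subLR addnCA.
(* Double counting: each vertex lies in at most one branch set. *)
have cardB : \sum_x #|B x| <= #|G|.
  under eq_bigr => x _ do rewrite -sum1_card.
  rewrite (exchange_big_dep predT) //= -sum1_card; apply: leq_sum => u _.
  rewrite sum1_card; apply/card_le1P => x xu y; rewrite !inE.
  apply/idP/eqP => [yu|->//]; exact: disjB yu xu.
have : \sum_(x < k) k <= \sum_(x < k) (#|B x| * d + 3).
  by apply: leq_sum => x _; exact: k_le.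
rewrite big_split /= -big_distrl /= !sum_nat_const card_ord => le_k.
by rewrite (leq_trans le_k) // mulnC [k * 3]mulnC leq_add // mulnC leq_mul.
Qed.

Lemma cart_prod_degree (G H : sgraph) (D E : nat) :
  max_degree_le G D -> max_degree_le H E -> max_degree_le (cart_prod G H) (D + E).
Proof.
move=> degG degH p; set A := [set x | edge p.1 x]; set B := [set y | edge p.2 y].
have sub : [set q | edge p q] \subset setX A [set p.2] :|: setX [set p.1] B.
  apply/subsetP=> -[x y]; rewrite !inE /= /cart_edge /=.
  by rewrite [_.2 == y]eq_sym [_.1 == x]eq_sym.
apply: leq_trans (subset_leq_card sub) _; apply: leq_trans (leq_card_setU _ _) _.
by rewrite !cardsX !cards1 muln1 mul1n; apply: leq_add; [apply: degG | apply: degH].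
Qed.

Lemma complete_graph_degree (n : nat) : max_degree_le (complete_graph n) n.-1.
Proof.
move=> x; rewrite -[n in n.-1]card_ord -(cardsC1 x); apply: subset_leq_card.
by apply/subsetP=> y; rewrite !inE /= /complete_edge /= eq_sym.
Qed.

Lemma card_rook (n m : nat) :
  #|cart_prod (complete_graph n) (complete_graph m)| = n * m.
Proof. by rewrite card_prod !card_ord. Qed.

Lemma rook_minor_bound (n m k : nat) : 0 < m -> 0 < n -> 4 <= n + m ->
  minor (complete_graph k) (cart_prod (complete_graph n) (complete_graph m)) ->
  k * k <= n * m * (n + m - 4) + 3 * k.
Proof.
move=> m_gt0 n_gt0 nm4; rewrite -(card_rook n m); apply: complete_minor_bound.
(* As [n] and [m] are positive and [4 <= n + m], nothing truncates in
   [n.-1 + m.-1 = (n + m - 4).+2]. *)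
have := cart_prod_degree (@complete_graph_degree n) (@complete_graph_degree m).
by congr max_degree_le; lia.
Qed.

Lemma hadwiger_le_card (G : sgraph) : hadwiger G <= #|G|.
Proof. by case: (hadwigerP G) => /minor_card; rewrite card_ord. Qed.

End UpperBound.

(** * The explicit complete minor and the lower bound *)

Section LowerBound.
Local Open Scope nat_scope.

Lemma connected_set_hub (G : sgraph) (S : {set G}) (z : G) : z \in S ->
  (forall u, u \in S ->
     connect [rel x y : G | [&& x \in S, y \in S & edge x y]] u z) ->
  connected_set S.
Proof.
move=> zS hub; rewrite /connected_set; apply/andP; split.
  by apply/set0Pn; exists z.
apply/forall_inP=> u uS; apply/forall_inP=> v vS.
by apply: connect_trans (hub u uS) _; rewrite connect_in_sym hub.
Qed.

(** Lists the pairs [u <= v] by increasing [v]: the binomial v(v+1)/2 counts the pairs whose larger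
    entry is below [v]. *)
Definition pair_code (u v : nat) : nat := 'C(v.+1, 2) + u.

Lemma pair_code_lt (u v t : nat) : u <= v -> v < t -> pair_code u v < 'C(t.+1, 2).
Proof.
move=> uv vt; apply: leq_trans (leq_bin2l 2 (vt : v.+2 <= t.+1)).
by rewrite /pair_code [X in _ < X]binS bin1; lia.
Qed.

(** The codes with larger entry [v] stay below 'C(v+2, 2), where the codes of the next block start,
    so blocks for different [v] cannot meet. *)
Lemma pair_code_inj (u v u' v' : nat) : u <= v -> u' <= v' ->
  pair_code u v = pair_code u' v' -> u = u' /\ v = v'.
Proof.
move=> uv uv'; have [lt|lt|<-] := ltngtP v v'; last by move/addnI.
- by have := pair_code_lt uv lt; rewrite /pair_code; lia.
- by have := pair_code_lt uv' lt; rewrite /pair_code; lia.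
Qed.

Lemma rook_complete_minor (n m t : nat) : 'C(t.+1, 2) <= m ->
  minor (complete_graph (t * n./2))
        (cart_prod (complete_graph n) (complete_graph m)).
Proof.
move=> le_tm; set h := n./2.
set G := cart_prod _ _.
(* [p.1] is the column and [p.2] the code of the row, so two vertices are adjacent when they differ
   in exactly one of these. *)
pose low (w a : nat) (p : G) := (p.1 == a.*2 :> nat) &&
  [exists v : 'I_t, (w <= v) && (p.2 == pair_code w v :> nat)].
pose high (w a : nat) (p : G) := (p.1 == a.*2.+1 :> nat) &&
  [exists u : 'I_t, (u <= w) && (p.2 == pair_code u w :> nat)].
pose branch (w a : nat) : {set G} := [set p | low w a p || high w a p].
have lowP w a (p : G) : low w a p -> p.1 = a.*2 :> nat /\
    exists2 v, w <= v & p.2 = pair_code w v :> nat.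
  by case/andP=> /eqP-> /existsP[v /andP[wv /eqP->]]; split=> //; exists v.
have highP w a (p : G) : high w a p -> p.1 = a.*2.+1 :> nat /\
    exists2 u, u <= w & p.2 = pair_code u w :> nat.
  by case/andP=> /eqP-> /existsP[u /andP[wu /eqP->]]; split=> //; exists u.
have cell c w v : c < n -> w <= v -> v < t ->
    exists2 p : G, p.1 = c :> nat & p.2 = pair_code w v :> nat.
  move=> cn wv vt; have rm := leq_trans (pair_code_lt wv vt) le_tm.
  by exists (Ordinal cn, Ordinal rm).
have in_low w v a (p : G) : w <= v -> v < t -> p.1 = a.*2 :> nat ->
    p.2 = pair_code w v :> nat -> p \in branch w a.
  move=> wv vt p1 p2; rewrite inE /low p1 eqxx /=; apply/orP; left.
  by apply/existsP; exists (Ordinal vt); rewrite /= wv p2 eqxx.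
have in_high u w a (p : G) : u <= w -> w < t -> p.1 = a.*2.+1 :> nat ->
    p.2 = pair_code u w :> nat -> p \in branch w a.
  move=> uw wt p1 p2; rewrite inE /high p1 eqxx /=; apply/orP; right.
  apply/existsP; exists (Ordinal (leq_ltn_trans uw wt)).
  by rewrite /= uw p2 eqxx.
have edge_row (p q : G) : p.1 != q.1 :> nat -> p.2 = q.2 :> nat -> edge p q.
  move=> n1 /val_inj e2; rewrite /edge /= /cart_edge /= /complete_edge /=.
  by rewrite e2 eqxx n1.
have edge_col (p q : G) : p.1 = q.1 :> nat -> p.2 != q.2 :> nat -> edge p q.
  move=> /val_inj e1 n2; rewrite /edge /= /cart_edge /= /complete_edge /=.
  by rewrite e1 eqxx n2 orbT.
(* The parity of the column tells whether [p] is in a low or a high part, and half the column gives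
   [a]; then [w] is the smaller, respectively larger, entry of the row. *)
have branch_inj w w' a a' p : p \in branch w a -> p \in branch w' a' ->
    w = w' /\ a = a'.
  rewrite !inE => /orP[/lowP|/highP] [p1 [v wv p2]] /orP[/lowP|/highP] [p1' [v' wv' p2']].
  - by case: (pair_code_inj wv wv'); [rewrite -p2 | split=> //; lia].
  - lia.
  - lia.
  - by case: (pair_code_inj wv wv'); [rewrite -p2 | split=> //; lia].
have branch_conn w a : w < t -> a < h -> connected_set (branch w a).
  move=> wt ah.
  have c0 : a.*2 < n by lia.
  have c1 : a.*2.+1 < n by lia.
  (* [z0] and [z1] are the two copies of row [(w, w)]; each part lies in one column and is therefore
     a clique. *)
  have [z0 z01 z02] := cell _ _ _ c0 (leqnn w) wt.
  have [z1 z11 z12] := cell _ _ _ c1 (leqnn w) wt.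
  have z0B : z0 \in branch w a by apply: (in_low w w).
  have z1B : z1 \in branch w a by apply: (in_high w w).
  apply: (@connected_set_hub _ _ z0) => // p pB.
  have := pB; rewrite inE => /orP[/lowP|/highP] [p1 [v wv p2]].
    have [p2z|p2z] := eqVneq (p.2 : nat) z0.2.
      suff -> : p = z0 by apply: connect0.
      by rewrite [p]surjective_pairing [z0]surjective_pairing;
        congr (_, _); apply: val_inj => //=; rewrite p1 z01.
    by apply: connect1; apply/and3P; split=> //; apply: edge_col; rewrite // p1 z01.
  have z10 : connect [rel x y : G | [&& x \in branch w a, y \in branch w a & edge x y]] z1 z0.
    by apply: connect1; apply/and3P; split=> //; apply: edge_row; rewrite ?z02 ?z12 // z01 z11; lia.
  apply: connect_trans z10.
  have [p2z|p2z] := eqVneq (p.2 : nat) z1.2.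
    suff -> : p = z1 by apply: connect0.
    by rewrite [p]surjective_pairing [z1]surjective_pairing;
      congr (_, _); apply: val_inj => //=; rewrite p1 z11.
  by apply: connect1; apply/and3P; split=> //; apply: edge_col; rewrite // p1 z11.
have branch_adj w w' a a' : w <= w' -> w' < t -> a < h -> a' < h ->
    exists2 p, p \in branch w a & exists2 q, q \in branch w' a' & edge p q.
  move=> ww w't ah ah'.
  have c0 : a.*2 < n by lia.
  have c1 : a'.*2.+1 < n by lia.
  (* Both vertices lie in row [(w, w')]; their columns have different parity, hence differ even when
     [a = a']. *)
  have [p p1 p2] := cell _ _ _ c0 ww w't.
  have [q q1 q2] := cell _ _ _ c1 ww w't.
  exists p; first exact: (in_low w w').
  exists q; first exact: (in_high w w').
  by apply: edge_row; rewrite ?p2 ?q2 // p1 q1; lia.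
(* Indices below [t * h] encode the pairs [(w, a)] by quotient and remainder modulo [h], which is
   positive as soon as an index exists. *)
have h_gt0 (x : 'I_(t * h)) : 0 < h by case: x => x; case: (h) => //; rewrite muln0.
have div_lt (x : 'I_(t * h)) : x %/ h < t by rewrite ltn_divLR ?(h_gt0 x).
have mod_lt (x : 'I_(t * h)) : x %% h < h by rewrite ltn_mod (h_gt0 x).
apply/existsP; exists [ffun x : 'I_(t * h) => branch (x %/ h) (x %% h)].
apply/and3P; split.
- by apply/forallP=> x; rewrite ffunE branch_conn.
- apply/forallP=> x; apply/forallP=> y; apply/implyP; apply: contraNT.
  rewrite !ffunE => /pred0Pn[p /andP[px py]].
  have [e1 e2] := branch_inj _ _ _ _ _ px py.
  by apply/eqP/val_inj => /=; rewrite (divn_eq x h) (divn_eq y h) e1 e2.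
- apply/forallP=> x; apply/forallP=> y; apply/implyP=> _; rewrite !ffunE.
  case/orP: (leq_total (x %/ h) (y %/ h)) => le_xy.
    have [p px [q qy pq]] := branch_adj _ _ _ _ le_xy (div_lt y) (mod_lt x) (mod_lt y).
    by apply/exists_inP; exists p => //; apply/exists_inP; exists q.
  have [p px [q qy pq]] := branch_adj _ _ _ _ le_xy (div_lt x) (mod_lt y) (mod_lt x).
  by apply/exists_inP; exists q => //; apply/exists_inP; exists p; rewrite // edge_sym.
Qed.

Lemma hadwiger_rook_lower (n m : nat) : exists2 t,
  2 * m <= t.+2 ^ 2 &
  t * n./2 <= hadwiger (cart_prod (complete_graph n) (complete_graph m)).
Proof.
have ex0 : exists t, 'C(t.+1, 2) <= m by exists 0.
have bnd t : 'C(t.+1, 2) <= m -> t <= m.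
  by apply: leq_trans; rewrite binS bin1 leq_addl.
case: (ex_maxnP ex0 bnd) => t tm tmax; exists t.
  (* Maximality of [t] gives 2m < (t+1)(t+2), which is below (t+2)^2. *)
  have : ~~ ('C(t.+2, 2) <= m) by apply/negP=> /tmax; rewrite ltnn.
  have := mul_bin_diag t.+2 1; rewrite bin1 -mulnn; nia.
by case: (hadwigerP (cart_prod (complete_graph n) (complete_graph m))) => _; apply;
  exact: rook_complete_minor.
Qed.

End LowerBound.

(** * The bounds over the reals *)

Local Open Scope ring_scope.

(** Strictness excludes [n + m = 4] because there [eta = U = 3]: the products are the 4-cycle and
    the triangle. *)
Theorem mainTheorem9 (R : realType) :
  exists C : R, 0 < C /\
  forall n m : nat, (1 <= m)%N -> (m <= n)%N ->
    let eta := (hadwiger (cart_prod (complete_graph n) (complete_graph m)))%:R : R in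
    let U := Num.sqrt ((n%:R + m%:R - 4) * n%:R * m%:R) + 3 : R in
    [/\ n%:R * Num.sqrt (m%:R / 2) - C * (n%:R + Num.sqrt m%:R) <= eta,
        eta <= U,
        (n + m != 4)%N -> eta < U
      & U <= n%:R * Num.sqrt (2 * m%:R) + 3].
Proof.
(* With s = sqrt(m/2), the minor has order at least (s-1)(n-1) >= ns - n - s, and s <= sqrt m; hence
   the constant 1. *)
exists 1; split=> // n m m1 mn eta U.
have mR : 1 <= m%:R :> R by rewrite ler1n.
have nR : m%:R <= n%:R :> R by rewrite ler_nat.
set N : R := (n%:R + m%:R - 4) * n%:R * m%:R in U *.
have U_gt : (n + m != 4)%N -> eta < U.
  (* For [n + m < 4] the radicand is negative and its [Num.sqrt] is 0, so [U = 3]; the graph has at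
     most two vertices. *)
  move=> nm4; have [nm_lt|nm_gt] := ltnP (n + m) 4.
    have : eta <= 2.
      rewrite /eta ler_nat; apply: leq_trans (hadwiger_le_card _) _.
      rewrite card_rook; nia.
    by rewrite /U; have := sqrtr_ge0 N; lra.
  have nmR : 4 < n%:R + m%:R :> R by rewrite -natrD ltr_nat ltn_neqAle eq_sym nm4.
  have N_gt0 : 0 < N by rewrite /N !mulr_gt0 //; lra.
  have sqrt_gt0 : 0 < Num.sqrt N by rewrite sqrtr_gt0.
  have n_gt0 := leq_trans m1 mn.
  have kk : eta * eta <= N + 3 * eta.
    have := rook_minor_bound m1 n_gt0 nm_gt (hadwigerP _).1; rewrite /= -(ler_nat R).
    rewrite natrD !natrM natrB // natrD -/eta; congr (_ <= _ + _).
    by rewrite /N; ring.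
  have sqrtN : Num.sqrt N ^+ 2 = N by rewrite sqr_sqrtr // ltW.
  (* If eta >= s + 3 with s = sqrt N > 0, then eta(eta - 3) >= s(s + 3) > N, against [kk]. *)
  by rewrite /U; nra.
have U_ge : eta <= U.
  have [nm4|/U_gt/ltW//] := eqVneq (n + m)%N 4.
  (* Here the degree term vanishes, leaving k^2 <= 3k. *)
  have kk := rook_minor_bound m1 (leq_trans m1 mn) (eq_leq (esym nm4)) (hadwigerP _).1.
  have k3 : eta <= 3.
    by rewrite /eta ler_nat; move: kk; rewrite /= nm4 subnn muln0 add0n; nia.
  by rewrite /U; have := sqrtr_ge0 N; lra.
split=> //.
- have [t t1 t2] := hadwiger_rook_lower n m.
  have t2R : t%:R * (n./2)%:R <= eta by rewrite /eta -natrM ler_nat.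
  have t1R : 2 * m%:R <= (t%:R + 2) ^+ 2 :> R.
    by rewrite -!natrD -natrX -natrM ler_nat addn2.
  have hR : n%:R - 1 <= 2 * (n./2)%:R :> R.
    by rewrite lerBlDr -natrM natr1 ler_nat; lia.
  set s := Num.sqrt (m%:R / 2).
  have s0 : 0 <= s by apply: sqrtr_ge0.
  have s2 : s ^+ 2 = m%:R / 2 by apply: sqr_sqrtr; lra.
  have sm : s <= Num.sqrt m%:R by apply: ler_wsqrtr; lra.
  have t0 : 0 <= t%:R :> R by apply: ler0n.
  have st : 2 * s <= t%:R + 2.
    by rewrite -(@ler_pXn2r _ 2) ?nnegrE //; [rewrite exprMn s2; lra | lra | lra].
  nra.
- rewrite lerD2r -[n%:R in leRHS]ger0_norm // -sqrtr_sqr -sqrtrM ?sqr_ge0 //.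
  have nm_ge0 : 0 <= n%:R * m%:R :> R by rewrite mulr_ge0.
  (* This product is exactly 2mn^2 - N. *)
  have : 0 <= (n%:R - m%:R + 4) * (n%:R * m%:R) :> R by rewrite mulr_ge0 //; lra.
  by move=> ?; apply: ler_wsqrtr; rewrite /N; nra.
Qed.
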